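(* Let $q$ be a prime power with $q\equiv 1\pmod 6$. If there exists a large set of Kirkman triple systems of order $q+2$ (an LKTS$(q+2)$), then there exists an LKTS$(q^n+2)$ for every integer $n\geq 2$.
   Context: A Steiner triple system STS$(v)$ is a pair $(X,\mathcal{B})$ with $|X|=v$ and $\mathcal{B}$ a collection of 3-subsets (blocks) of $X$ such that every 2-subset of $X$ lies in exactly one block. A Kirkman triple system KTS$(v)$ is an STS$(v)$ whose block set admits a partition into parallel classes, i.e. classes each of which is a partition of $X$. Two STS$(v)$ on the same set are disjoint if they share no block. A large set of Kirkman triple systems of order $v$, LKTS$(v)$, is a collection of $v-2$ pairwise disjoint STS$(v)$ on the same $v$-set (hence together containing every 3-subset exactly once) each of which is resolvable (a KTS$(v)$). *)

(* Defs.v *)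
From mathcomp Require Import all_boot.
Set Implicit Arguments.
Unset Strict Implicit.
Unset Printing Implicit Defensive.

Definition prime_power (q : nat) : Prop :=
  exists p k : nat, [/\ prime p, 0 < k & q = p ^ k].

Section Designs.
Variable X : finType.
Implicit Type B : {set {set X}}.

Definition is_STS B : Prop :=
  (forall b : {set X}, b \in B -> #|b| = 3) /\
  (forall e : {set X}, #|e| = 2 -> exists! b : {set X}, b \in B /\ e \subset b).

Definition parallel_class (C : {set {set X}}) : Prop := partition C [set: X].

Definition resolvable B : Prop :=
  exists2 R : {set {set {set X}}},
    partition R B & forall C, C \in R -> parallel_class C.

Definition is_KTS B : Prop := is_STS B /\ resolvable B.

(* The collection is a set of systems, so disjointness is asked of distinct
   members.  The subtraction is truncated, hence meaningful for #|X| >= 2. *)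
Definition is_LKTS (L : {set {set {set X}}}) : Prop :=
  [/\ #|L| = #|X| - 2,
      forall B, B \in L -> is_KTS B
    & forall B1 B2, B1 \in L -> B2 \in L -> B1 != B2 -> [disjoint B1 & B2]].

End Designs.

Definition LKTS_exists (v : nat) : Prop :=
  exists (X : finType) (L : {set {set {set X}}}), #|X| = v /\ is_LKTS L.

(* Main.v *)
Require Import Defs.
From mathcomp Require Import all_boot all_fingroup all_algebra all_solvable all_field.
From mathcomp Require Import ring.


(* Take the point set V + {oo1, oo2} with V = F^n, |F| = q, and relabel the
   given LKTS(q+2) on F + {oo1, oo2} so that its t-th system contains
   {oo1, oo2, t}.  The x-th new system consists of
   - on each line l through x, the copy on l + {oo1, oo2} of the system whose
     label is the coordinate of x on l;
   - the triples {y, z, u} of points of V with y + z + u = 3x that are not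
     collinear with x.
   For the parallel classes, let w be a primitive cube root of unity in F (it
   exists as q = 1 mod 3).  The second kind of triples are the sets
   {x + w^k a + w^-k b | k = 0, 1, 2} with a, b independent, where {a, b} is
   determined up to replacing (a, b) by (wa, w^-1 b).  Let D(a, b) be a
   determinant in the plane spanned by a and b, and split F \ {0} into H and -H.
   Order {a, b} so that D(a, b) lies in H.  Given a direction e and h in H, the
   triples with b on the line Fe and D(a, b) = h partition the complement of the
   line x + Fe: through x + v, with v not in Fe, passes the one with a + b = v
   and D(v, b) = h.  The copy of the system of order q+2 on x + Fe has (q-1)/2 = |H|
   parallel classes not containing {oo1, oo2, x}; each of them is completed by
   the triples belonging to one h.  The classes through {oo1, oo2, x} on all the
   lines through x together form one more class. *)

Set Implicit Arguments.
Unset Strict Implicit.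
Unset Printing Implicit Defensive.

(* A Kirkman triple system presented by its parallel classes [cls i], indexed by
   the colours [i] in [A]. *)
Record kirkman (X I : finType) (A : {set I}) (cls : I -> {set {set X}}) : Prop :=
  Kirkman {
    kirkman_card : forall i b, i \in A -> b \in cls i -> #|b| = 3;
    kirkman_cover : forall i p, i \in A -> exists2 b, b \in cls i & p \in b;
    kirkman_class_uniq : forall i b b' p, i \in A -> b \in cls i ->
      b' \in cls i -> p \in b -> p \in b' -> b = b';
    kirkman_pair : forall p p', p != p' ->
      exists i b, [/\ i \in A, b \in cls i, p \in b & p' \in b];
    kirkman_pair_uniq : forall i i' b b' p p', i \in A -> i' \in A ->
      b \in cls i -> b' \in cls i' -> p != p' ->
      p \in b -> p' \in b -> p \in b' -> p' \in b' -> b = b' /\ i = i'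
  }.

(** * Kirkman triple systems and their colour classes *)

Section Kirkman.
Variables (X I : finType).
Implicit Types (A : {set I}) (B : {set {set X}}).

Lemma card3_pair (b : {set X}) :
  #|b| = 3 -> exists p p', [/\ p != p', p \in b & p' \in b].
Proof.
move=> b3; have: 1 < #|b| by rewrite b3.
by case/card_gt1P=> p [p' [pb p'b npp']]; exists p, p'.
Qed.

(** A block has two distinct points, which determine its colour by [kirkman_pair_uniq], so distinct
    classes share no block. A point of [X] makes every class nonempty, as [partition] demands. *)
Lemma kirkman_KTS A (cls : I -> {set {set X}}) : 0 < #|X| -> kirkman A cls ->
  is_KTS (\bigcup_(i in A) cls i).
Proof.
move=> /card_gt0P[x0 _] [K3 Kcov Kcls Kpair Kuniq]; split.
  split=> [b /bigcupP[i iA bi]|e /eqP/cards2P[p [p' [npp' ->]]]].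
    exact: K3 bi.
  have [i [b [iA bi pb p'b]]] := Kpair _ _ npp'; exists b; split.
    split; first by apply/bigcupP; exists i.
    by rewrite subUset !sub1set pb.
  move=> b' [/bigcupP[i' i'A b'i']]; rewrite subUset !sub1set => /andP[pb' p'b'].
  by have [] := Kuniq _ _ _ _ _ _ iA i'A bi b'i' npp' pb p'b pb' p'b'.
exists (cls @: A); last first.
  move=> _ /imsetP[i iA ->]; apply/and3P; split.
  - rewrite -subTset; apply/subsetP=> p _; have [b bi pb] := Kcov _ p iA.
    by apply/bigcupP; exists b.
  - apply/trivIsetP=> b b' bi b'i; apply: contraNT => /pred0Pn[p /andP[/= pb pb']].
    by apply/eqP; apply: (Kcls i b b' p).
  - by apply/negP=> /(K3 _ _ iA); rewrite cards0.
apply/and3P; split.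
- by rewrite cover_imset.
- apply/trivIsetP=> _ _ /imsetP[i iA ->] /imsetP[i' i'A ->].
  apply: contraNT => /pred0Pn[b /andP[/= bi bi']].
  have [p [p' [npp' pb p'b]]] := card3_pair (K3 _ _ iA bi).
  by have [_ ->] := Kuniq _ _ _ _ _ _ iA i'A bi bi' npp' pb p'b pb p'b.
- apply/negP=> /imsetP[i iA ci0]; have [b] := Kcov _ x0 iA.
  by rewrite -ci0 inE.
Qed.

Lemma STS_pair_uniq B b b' p p' : is_STS B -> b \in B -> b' \in B -> p != p' ->
  p \in b -> p' \in b -> p \in b' -> p' \in b' -> b = b'.
Proof.
move=> [_ Buniq] bB b'B npp' pb p'b pb' p'b'.
have [|b0 [_ b0P]] := Buniq [set p; p']; first by rewrite cards2 npp'.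
have b0E c : c \in B -> p \in c -> p' \in c -> b0 = c.
  by move=> cB pc p'c; apply: b0P; rewrite subUset !sub1set pc.
by rewrite -(b0E b) // (b0E b').
Qed.

Lemma STS_pair B p p' : is_STS B -> p != p' ->
  exists b, [/\ b \in B, p \in b & p' \in b].
Proof.
move=> [_ Buniq] npp'; have [|b [[bB]]] := Buniq [set p; p'].
  by rewrite cards2 npp'.
by rewrite subUset !sub1set => /andP[pb p'b] _; exists b.
Qed.

Section Resolution.
Variables (B : {set {set X}}) (R : {set {set {set X}}}).
Hypotheses (BS : is_STS B) (RB : partition R B)
  (Rpar : forall C, C \in R -> parallel_class C).

Let coverR : cover R = B. Proof. exact: cover_partition. Qed.
Let trivR : trivIset R. Proof. by case/and3P: RB. Qed.

Lemma resolution_sub C b : C \in R -> b \in C -> b \in B.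
Proof. by move=> CR bC; rewrite -coverR; apply/bigcupP; exists C. Qed.

Lemma resolution_pblock C p :
  C \in R -> pblock C p \in C /\ p \in pblock C p.
Proof.
move=> CR; have pC : p \in cover C by rewrite (cover_partition (Rpar CR)) inE.
by split; [apply: pblock_mem | rewrite mem_pblock].
Qed.

(* A point lies in one block of each class, and these blocks pair up the
   other points. *)
Lemma card_resolution (p : X) : #|X| = (#|R| * 2).+1.
Proof.
pose f C := pblock C p :\ p.
have pb := fun C => @resolution_pblock C p.
have injf : {in R &, injective f}.
  move=> C C' CR C'R eqf.
  have eqb : pblock C p = pblock C' p.
    rewrite -(setD1K (pb _ CR).2) -[in RHS](setD1K (pb _ C'R).2).
    by rewrite -/(f C) eqf.
  rewrite -(def_pblock trivR CR (pb _ CR).1).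
  by rewrite (def_pblock trivR C'R) // eqb; case: (pb _ C'R).
have fP : partition (f @: R) [set~ p].
  apply/and3P; split.
  - apply/eqP/setP=> p'; rewrite !inE; apply/bigcupP/idP.
      by case=> _ /imsetP[C CR ->]; rewrite !inE => /andP[].
    move=> np'p; have [b [bB p'b pinb]] := STS_pair BS np'p.
    have: b \in cover R by rewrite coverR.
    case/bigcupP=> C CR bC; exists (f C); first by apply: imset_f.
    have trivC : trivIset C by case/and3P: (Rpar CR).
    by rewrite !inE np'p (def_pblock trivC bC pinb).
  - apply/trivIsetP=> _ _ /imsetP[C CR ->] /imsetP[C' C'R ->].
    apply: contraNT => /pred0Pn[p' /andP[/=]]; rewrite !inE.
    case/andP=> np'p p'b /andP[_ p'b']; apply/eqP; rewrite /f.
    have [bC pin] := pb _ CR; have [b'C' pin'] := pb _ C'R.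
    by rewrite (STS_pair_uniq BS (resolution_sub CR bC)
      (resolution_sub C'R b'C') np'p p'b pin p'b' pin').
  - apply/negP=> /imsetP[C CR /esym/eqP]; rewrite -cards_eq0 => /eqP f0.
    have [bC pin] := pb _ CR.
    have := BS.1 _ (resolution_sub CR bC); rewrite (cardsD1 p) pin.
    by rewrite -/(f C) f0.
rewrite -cardsT (cardsD1 p) inE /= setTD add1n; congr _.+1.
rewrite -(card_in_imset injf); apply: card_uniform_partition fP.
move=> _ /imsetP[C CR ->]; have [bC pin] := pb _ CR.
have := BS.1 _ (resolution_sub CR bC); rewrite (cardsD1 p) pin => /eqP.
by rewrite eqSS => /eqP.
Qed.

End Resolution.

Lemma bij_on_pointed (T : finType) A (D : {set T}) a0 d0 : #|D| = #|A| ->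
  a0 \in A -> d0 \in D ->
  exists f : T -> I, [/\ {in D, forall d, f d \in A}, {in D &, injective f},
    {in A, forall a, exists2 d, d \in D & f d = a} & f d0 = a0].
Proof.
move=> DA a0A d0D.
pose f0 d := nth a0 (enum A) (index d (enum D)).
have f0A d : d \in D -> f0 d \in A.
  by move=> dD; rewrite -mem_enum mem_nth // -cardE -DA cardE index_mem mem_enum.
have f0I : {in D &, injective f0}.
  move=> d d' dD d'D /eqP; rewrite nth_uniq ?enum_uniq -?cardE -?DA ?cardE
    ?index_mem ?mem_enum // => /eqP.
  by apply: (index_inj d0); rewrite mem_enum.
(* Both [a0] and [f0 d0] lie in [A], so the transposition preserves [A]; it corrects the value at
   [d0]. *)
pose f d := tperm a0 (f0 d0) (f0 d).
have fA d : d \in D -> f d \in A.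
  by move=> dD; rewrite /f; case: tpermP => *; rewrite ?f0A.
have fI : {in D &, injective f} by move=> d d' dD d'D /perm_inj/f0I; apply.
exists f; split=> // [a aA|]; last by rewrite /f tpermR.
have /eqP fD : f @: D == A.
  rewrite eqEcard (card_in_imset fI) DA leqnn andbT.
  by apply/subsetP=> _ /imsetP[d dD ->]; apply: fA.
by move: aA; rewrite -fD => /imsetP[d dD ->]; exists d.
Qed.

(** By [card_resolution] the size of [X] forces exactly [#|A|] parallel classes, so [A] can serve as
    their set of names. *)
Lemma KTS_kirkman A B a0 b0 : is_KTS B -> #|X| = (#|A| * 2).+1 ->
  a0 \in A -> b0 \in B ->
  exists cls : I -> {set {set X}},
    [/\ kirkman A cls, forall i, i \in A -> cls i \subset B & b0 \in cls a0].
Proof.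
move=> [BS [R RB Rpar]] cX a0A b0B.
have coverR : cover R = B := cover_partition RB.
have trivR : trivIset R by case/and3P: RB.
have b0R : b0 \in cover R by rewrite coverR.
have [p pb0] : exists p, p \in b0.
  by apply/set0Pn; rewrite -cards_eq0 (BS.1 _ b0B).
have cR : #|R| = #|A|.
  have := card_resolution BS RB Rpar p; rewrite cX => /eqP.
  by rewrite eqSS eqn_mul2r => /eqP.
have [f [fA fI fS f0]] := bij_on_pointed cR a0A (pblock_mem b0R).
exists (fun i => [set b in B | f (pblock R b) == i]); split; last first.
- by rewrite inE b0B f0 eqxx.
- by move=> i _; apply/subsetP=> b; rewrite inE => /andP[].
have inC i b : b \in [set b in B | f (pblock R b) == i] ->
    b \in B /\ f (pblock R b) = i.
  by rewrite inE => /andP[bB /eqP].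
split.
- by move=> i b _ /inC[bB _]; apply: BS.1.
- move=> i p' /fS[C CR <-]; have [bC p'b] := resolution_pblock Rpar p' CR.
  exists (pblock C p') => //; rewrite inE (def_pblock trivR CR bC) eqxx andbT.
  exact: resolution_sub RB _ _ CR bC.
- move=> i b b' p' iA /inC[bB fb] /inC[b'B fb'] p'b p'b'.
  have bR : b \in cover R by rewrite coverR.
  have b'R : b' \in cover R by rewrite coverR.
  have eqC : pblock R b = pblock R b'.
    by apply: fI; rewrite ?pblock_mem // fb fb'.
  have trivC : trivIset (pblock R b) by case/and3P: (Rpar _ (pblock_mem bR)).
  have bC : b \in pblock R b by rewrite mem_pblock.
  have b'C : b' \in pblock R b by rewrite eqC mem_pblock.
  by rewrite -(def_pblock trivC bC p'b) (def_pblock trivC b'C p'b').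
- move=> p1 p2 n12; have [b [bB p1b p2b]] := STS_pair BS n12.
  exists (f (pblock R b)), b; split; rewrite ?inE ?bB ?eqxx //.
  by apply/fA/pblock_mem; rewrite coverR.
- move=> i i' b b' p1 p2 iA i'A /inC[bB fb] /inC[b'B fb'] n12 p1b p2b p1b' p2b'.
  by have E := STS_pair_uniq BS bB b'B n12 p1b p2b p1b' p2b'; rewrite -fb -fb' E.
Qed.

End Kirkman.

(** * Transport along bijections and relabelling of the given large set *)

Lemma kirkman_bij (X Y I : finType) (A : {set I}) (cls : I -> {set {set X}})
    (g : Y -> X) : bijective g -> kirkman A cls ->
  kirkman A (fun i => [set b : {set Y} | g @: b \in cls i]).
Proof.
case=> g' gK g'K [K3 Kcov Kcls Kpair Kuniq].
have gI := can_inj gK; have gIs := imset_inj gI.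
have pull (b : {set X}) : g @: (g' @: b) = b.
  by rewrite -imset_comp (eq_imset _ g'K) imset_id.
have memg p (b : {set Y}) : p \in b -> g p \in g @: b by exact: imset_f.
have mempull p (b : {set X}) : g p \in b -> p \in g' @: b.
  by move=> pb; rewrite -[p]gK imset_f.
split.
- by move=> i b iA; rewrite inE => /(K3 _ _ iA); rewrite card_imset.
- move=> i p iA; have [b bi pb] := Kcov _ (g p) iA.
  by exists (g' @: b); rewrite ?inE ?pull ?mempull.
- move=> i b b' p iA; rewrite !inE => bi b'i pb pb'; apply: gIs.
  by apply: (Kcls i _ _ (g p)); rewrite ?memg.
- move=> p p' npp'; have [|i [b [iA bi pb p'b]]] := Kpair (g p) (g p').
    by rewrite (inj_eq gI).
  by exists i, (g' @: b); rewrite inE pull; split; rewrite ?mempull.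
- move=> i i' b b' p p' iA i'A; rewrite !inE => bi b'i' npp' pb p'b pb' p'b'.
  have ng : g p != g p' by rewrite (inj_eq gI).
  by have [] := Kuniq i i' _ _ _ _ iA i'A bi b'i' ng (memg _ _ pb)
    (memg _ _ p'b) (memg _ _ pb') (memg _ _ p'b') => [/gIs -> ->].
Qed.

Lemma eq_card_bijective (X Y : finType) : #|X| = #|Y| ->
  exists f : X -> Y, bijective f.
Proof.
move=> eqXY; exists (enum_val \o cast_ord eqXY \o enum_rank).
apply: bij_comp; first apply: bij_comp.
- exact: enum_val_bij.
- by exists (cast_ord (esym eqXY)); [apply: cast_ordK | apply: cast_ordKV].
- exact: enum_rank_bij.
Qed.

Definition special (T : finType) (t : T) : {set T + bool} :=
  [set inr true; inr false; inl t].

(** Each system has one block through the two infinite points (the values of [bool]), and its third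
    point is the label. Disjoint systems have different labels, and there are [#|T|] systems, so
    each [t] labels exactly one. *)
Lemma LKTS_kirkman (T I : finType) (A : {set I}) (a0 : I) :
  LKTS_exists (#|T| + 2) -> a0 \in A -> #|T|.+1 = #|A| * 2 ->
  exists K : T -> I -> {set {set T + bool}},
    [/\ forall t, kirkman A (K t),
        forall t, special t \in K t a0
      & forall t t' i i' b, i \in A -> i' \in A ->
          b \in K t i -> b \in K t' i' -> t = t'].
Proof.
move=> [X [L [cX [cL LK Ldis]]]] a0A cA.
have [|g gbij] := @eq_card_bijective (T + bool)%type X.
  by rewrite card_sum card_bool cX.
have gI := bij_inj gbij; have gIs := imset_inj gI.
have cspec t : #|g @: special t| = 3.
  by rewrite card_imset // /special setUC cardsU1 cards2 !inE.
have gspec t : (g (inr true) \in g @: special t) && (g (inr false) \in g @: special t).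
  by rewrite !mem_imset // !inE.
have Lspec B : B \in L -> exists t, g @: special t \in B.
  move=> /LK[BS _]; have [|b [bB b1 b2]] :=
    @STS_pair _ B (g (inr true)) (g (inr false)) BS.
    by rewrite (inj_eq gI).
  have : 0 < #|b :\: [set g (inr true); g (inr false)]|.
    rewrite cardsD (setIidPr _) ?(BS.1 _ bB) ?cards2 ?(inj_eq gI) //.
    by rewrite subUset !sub1set b1.
  case/card_gt0P=> x; rewrite !inE negb_or => /andP[/andP[nx1 nx2] xb].
  have [g' gK g'K] := gbij; case E: (g' x) => [t|c]; last first.
    by move: nx1 nx2; rewrite -[x]g'K E !(inj_eq gI); case: (c).
  exists t; suff -> : g @: special t = b by [].
  apply/eqP; rewrite eqEcard cspec (BS.1 _ bB) andbT.
  apply/subsetP=> _ /imsetP[y ys ->]; move: ys; rewrite !inE.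
  by case/orP=> [/orP[]|] /eqP-> //; rewrite -E g'K.
have specI B t t' : B \in L -> g @: special t \in B -> g @: special t' \in B -> t = t'.
  move=> /LK[BS _] sB sB'; have [/andP[a b] /andP[c d]] := (gspec t, gspec t').
  have: special t = special t'.
    by apply/gIs/(STS_pair_uniq BS sB sB' _ a b c d); rewrite (inj_eq gI).
  by move/setP/(_ (inl t)); rewrite !inE eqxx => /esym/eqP[].
have specB t : exists2 B, B \in L & g @: special t \in B.
  pose f (B : {set {set X}}) := odflt t [pick t | g @: special t \in B].
  have fP B : B \in L -> g @: special (f B) \in B.
    move=> /Lspec[t0 t0B]; rewrite /f; case: pickP => //= /(_ t0).
    by rewrite t0B.
  have fI : {in L &, injective f}.
    move=> B B' BL B'L eqf; apply/eqP; apply: contraT => /(Ldis _ _ BL B'L).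
    by move/pred0P/(_ (g @: special (f B))); rewrite /= fP // eqf fP.
  have: t \in f @: L.
    suff -> : f @: L = setT by rewrite inE.
    apply/eqP; rewrite eqEcard subsetT cardsT (card_in_imset fI) cL cX.
    by rewrite addnK /=.
  by case/imsetP=> B BL ->; exists B => //; apply: fP.
have choice t : exists BK : {set {set X}} * (I -> {set {set X}}),
    [/\ BK.1 \in L, kirkman A BK.2, forall i, i \in A -> BK.2 i \subset BK.1
      & g @: special t \in BK.2 a0].
  have [B BL sB] := specB t.
  have [|cls [clsK clsB s0]] := KTS_kirkman (LK B BL) _ a0A sB.
    by rewrite cX addn2 cA.
  by exists (B, cls).
have [BK BKP] := fin_all_exists choice.
exists (fun t i => [set b : {set T + bool} | g @: b \in (BK t).2 i]); split.
- by move=> t; have [_ BKK _ _] := BKP t; apply: kirkman_bij.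
- by move=> t; rewrite inE; have [] := BKP t.
- move=> t t' i i' b iA i'A; rewrite !inE => bi b'i'.
  have [BL _ sub s] := BKP t; have [BL' _ sub' s'] := BKP t'.
  have eqB : (BK t).1 = (BK t').1.
    apply/eqP; apply: contraT => /(Ldis _ _ BL BL')/pred0P/(_ (g @: b)).
    by rewrite /= (subsetP (sub _ iA)) // (subsetP (sub' _ i'A)).
  apply: (specI _ _ _ BL); first exact: (subsetP (sub _ a0A)).
  by rewrite eqB; apply: (subsetP (sub' _ a0A)).
Qed.

(** * Half of the nonzero elements, and a cube root of unity, in a finite field *)

Import GRing.Theory.
Local Open Scope ring_scope.

(** As 2 is nonzero, [x] and [- x] differ for nonzero [x]; [H] takes from each such pair the element
    of smaller rank. *)
Lemma half_nonzero (F : finFieldType) : 2%:R != 0 :> F ->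
  exists H : {set F}, [/\ 0 \notin H, forall x : F, x != 0 -> (- x \in H) = (x \notin H)
    & (#|F| = (#|H| * 2).+1)%N].
Proof.
move=> F2; pose H := [set x : F | (enum_rank x < enum_rank (- x))%N].
have H0 : 0 \notin H by rewrite inE oppr0 ltnn.
have HN (x : F) : x != 0 -> (- x \in H) = (x \notin H).
  move=> x0; rewrite !inE opprK -leqNgt ltn_neqAle andb_idl // => _.
  apply: contraNneq F2 => /ord_inj/enum_rank_inj/esym/eqP.
  by rewrite -addr_eq0 -mulr2n -(mulr_natl x) mulf_eq0 (negPf x0) orbF.
have nzH x : x \in H -> x != 0 by apply: contraTneq => ->.
exists H; split=> //; rewrite -cardsT (cardsD1 (0 : F)) inE add1n; congr _.+1.
have -> : [set: F] :\ (0 : F) = H :|: -%R @: H.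
  apply/setP=> x; rewrite in_setD1 inE andbT in_setU; apply/idP/orP.
    move=> x0; case xH: (x \in H); [by left | right].
    by apply/imsetP; exists (- x); rewrite ?opprK // HN // xH.
  by case=> [/nzH//|/imsetP[y /nzH y0 ->]]; rewrite oppr_eq0.
rewrite cardsU (card_imset _ oppr_inj) muln2 -addnn.
suff -> : H :&: -%R @: H = set0 by rewrite cards0 subn0.
apply/setP=> x; rewrite in_setI in_set0; apply/negP=> /andP[xH /imsetP[y yH xy]].
by move: (HN y (nzH y yH)); rewrite yH -xy xH.
Qed.

(** Cauchy's theorem gives a unit of order 3, a root of [X^3 - 1 = (X - 1)(X^2 + X + 1)] other than
    1. *)
Lemma cube_root1 (F : finFieldType) : 3%:R != 0 :> F -> (3 %| #|F|.-1)%N ->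
  exists w : F, w * w = - 1 - w.
Proof.
move=> F3 dvd3; have [|u _ u3] := @Cauchy _ 3 [set: {unit F}]%G isT.
  by rewrite card_finField_unit.
have u1 : val u != 1.
  by apply/eqP=> u1; move: u3; rewrite (_ : u = 1%g) ?order1 //; apply: val_inj.
have H : val u ^+ 3 = 1 by rewrite -FinRing.val_unitX -u3 expg_order.
exists (val u); apply/eqP; rewrite -subr_eq0.
have -> : val u * val u - (- 1 - val u) = val u * val u + val u + 1 by ring.
have: (val u - 1) * (val u * val u + val u + 1) == 0.
  rewrite (_ : _ * _ = val u ^+ 3 - 1); last by ring.
  by rewrite H subrr.
by rewrite mulf_eq0 subr_eq0 (negPf u1).
Qed.

(** * Normalised directions and a planewise determinant *)

Section Lead.
Variable F : fieldType.

(* The coordinate of [B] at the position of the first nonzero entry of [A]; for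
   [lead e = 1] it parametrises every line of direction [e]. *)
Definition coord m n (A B : 'M[F]_(m, n)) : F :=
  if [pick ij | A ij.1 ij.2 != 0] is Some ij then B ij.1 ij.2 else 0.

Definition lead m n (A : 'M[F]_(m, n)) : F := coord A A.

Lemma coord_lin m n (A B C : 'M[F]_(m, n)) c :
  coord A (B + c *: C) = coord A B + c * coord A C.
Proof. by rewrite /coord; case: pickP => *; rewrite ?mxE ?mulr0 ?addr0. Qed.

Lemma coord0 m n (A : 'M[F]_(m, n)) : coord A 0 = 0.
Proof. by rewrite /coord; case: pickP => *; rewrite ?mxE. Qed.

Lemma coordZ m n (A B : 'M[F]_(m, n)) c : coord A (c *: B) = c * coord A B.
Proof. by rewrite -[c *: B]add0r coord_lin coord0 add0r. Qed.

Lemma leadZ m n c (A : 'M[F]_(m, n)) : lead (c *: A) = c * lead A.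
Proof.
rewrite /lead; have [->|c0] := eqVneq c 0; first by rewrite scale0r coord0 mul0r.
rewrite coordZ; congr (_ * _); rewrite /coord.
by under eq_pick => ij do rewrite mxE mulf_eq0 (negPf c0).
Qed.

Lemma lead_eq0 m n (A : 'M[F]_(m, n)) : (lead A == 0) = (A == 0).
Proof.
apply/eqP/eqP=> [|->]; last exact: coord0.
rewrite /lead /coord; case: pickP => [ij /negPf nz /eqP|A0 _].
  by rewrite nz.
by apply/matrixP=> i j; rewrite mxE; have /negbFE/eqP := A0 (i, j).
Qed.

Variable n : nat.
Implicit Types (a b e : 'rV[F]_n) (c d t : F).

(* Restricted to any given plane this is a nonzero alternating form: one of the
   2x2 minors, chosen according to the plane only. *)
Definition det2 a b : F := lead (\matrix_(i, j) (a 0 i * b 0 j - b 0 i * a 0 j)).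

(** All 2x2 minors are multiplied by the same factor, and [lead] is homogeneous. *)
Lemma det2_comb a b c d c' d' :
  det2 (c *: a + d *: b) (c' *: a + d' *: b) = (c * d' - c' * d) * det2 a b.
Proof.
rewrite -leadZ; congr lead; apply/matrixP=> i j; rewrite !mxE; ring.
Qed.

Lemma det2C a b : det2 b a = - det2 a b.
Proof.
have := det2_comb a b 0 1 1 0; rewrite !scale0r !scale1r add0r addr0 => ->.
ring.
Qed.

Lemma det2Z a b c d : det2 (c *: a) (d *: b) = c * d * det2 a b.
Proof.
have := det2_comb a b c 0 0 d; rewrite !scale0r addr0 add0r => ->.
by rewrite mul0r subr0.
Qed.

Lemma det2_shift a b c : det2 (a + c *: b) b = det2 a b.
Proof.
have := det2_comb a b 1 c 0 1; rewrite !scale0r !scale1r add0r => ->.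
ring.
Qed.

Lemma det2_line e c d : det2 (c *: e) (d *: e) = 0.
Proof.
rewrite det2Z -[RHS](mulr0 (c * d)); congr (_ * _).
by apply/eqP; rewrite lead_eq0; apply/eqP/matrixP=> i j; rewrite !mxE subrr.
Qed.

Lemma det2_eq0 a e : e != 0 -> det2 a e = 0 -> exists c, a = c *: e.
Proof.
case/rV0Pn=> j ej /eqP; rewrite lead_eq0 => /eqP/matrixP de0.
exists (a 0 j / e 0 j); apply/rowP=> i; rewrite !mxE.
have /eqP := de0 i j; rewrite !mxE subr_eq0 => /eqP H.
by rewrite mulrAC [a 0 j * _]mulrC -H mulfK.
Qed.

Lemma dir_uniq e e' c c' : lead e = 1 -> lead e' = 1 -> c != 0 ->
  c *: e = c' *: e' -> e = e'.
Proof.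
move=> e1 e'1 c0 E; have := congr1 (@lead _ _) E.
by rewrite !leadZ e1 e'1 !mulr1 => cc; apply: (scalerI c0); rewrite E cc.
Qed.

Lemma dirP a : a != 0 -> exists2 e, lead e = 1 & exists2 c, c != 0 & a = c *: e.
Proof.
rewrite -lead_eq0 => a0; exists ((lead a)^-1 *: a).
  by rewrite leadZ mulVf.
by exists (lead a); rewrite // scalerA mulfV // scale1r.
Qed.

Lemma dir_neq0 e : lead e = 1 -> e != 0.
Proof. by move=> e1; rewrite -lead_eq0 e1 oner_eq0. Qed.

End Lead.

(** * Lines with two infinite points, and triples around a centre *)

Section Geometry.
Variables (F : finFieldType) (n : nat).
Local Notation V := 'rV[F]_n.
Implicit Types (a b e x u v : V) (c d s t : F).

(* The bijection from [F + bool] to the line [x + F e] with the two infinite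
   points that identifies [F] with the line by [coord e]. *)
Definition line_pt x e (y : F + bool) : V + bool :=
  match y with
  | inl s => inl (x + (s - coord e x) *: e)
  | inr i => inr i
  end.

Lemma line_pt_inj x e : lead e = 1 -> injective (line_pt x e).
Proof.
move=> e1 [s|i] [s'|i'] //= [] => [/addrI|->] // /eqP.
rewrite -subr_eq0 -scalerBl scaler_eq0 (negPf (dir_neq0 e1)) orbF subr_eq0.
by move/eqP/addIr->.
Qed.

(** The parametrisation depends on the line only, so two centres on one line copy their systems to
    it by the same map. *)
Lemma line_pt_shift x e c : lead e = 1 -> line_pt (x + c *: e) e =1 line_pt x e.
Proof.
move=> e1 [s|//]; rewrite /= coord_lin -/(lead e) e1; congr inl.
by apply/rowP=> i; rewrite !mxE; ring.
Qed.

Lemma line_ptE x e c : line_pt x e (inl (coord e x + c)) = inl (x + c *: e).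
Proof. by rewrite /= [_ + c]addrC addrK. Qed.

Lemma line_pt_inl x e v y : inl v = line_pt x e y ->
  exists2 c, y = inl (coord e x + c) & v = x + c *: e.
Proof.
case: y => [s|//] [->]; exists (s - coord e x) => //.
by rewrite addrC subrK.
Qed.

Variables (w : F).
Hypotheses (w2 : w * w = - 1 - w) (F3 : 3%:R != 0 :> F).
Local Notation w' := (- 1 - w).

(* The points [x + w^k a + w^-k b]; here [- 1 - w] is [w^-1]. *)
Definition tri x a b : {set V + bool} :=
  [set inl (x + (a + b)); inl (x + (w *: a + w' *: b));
       inl (x + (w' *: a + w *: b))].

(** The square of this difference is -3. *)
Lemma wNw' : w' - w != 0.
Proof.
apply: contraNneq F3 => ww'; have : (w' - w) * (w' - w) = - 3%:R by ring: w2.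
by rewrite ww' mul0r => /esym/eqP; rewrite oppr_eq0.
Qed.

Lemma triC x a b : tri x b a = tri x a b.
Proof.
rewrite /tri [b + a]addrC [w *: b + _]addrC [w' *: b + _]addrC.
by rewrite -!setUA [[set inl (x + (w' *: a + _))] :|: _]setUC.
Qed.

Lemma tri_rot x a b : tri x (w *: a) (w' *: b) = tri x a b.
Proof.
rewrite /tri !scalerA w2.
have -> : w' * w' = w by ring: w2.
have -> : w' * w = 1 by ring: w2.
have -> : w * w' = 1 by ring: w2.
by rewrite !scale1r [LHS]setUC setUA.
Qed.

(** By [tri_rot] any vertex can be taken as the one with [k = 0]; [(c, d)] is [(1, 1)], [(w, w')] or
    [(w', w)]. *)
Lemma tri_at x a b p : p \in tri x a b ->
  exists c d, [/\ c * d = 1, p = inl (x + (c *: a + d *: b))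
    & tri x (c *: a) (d *: b) = tri x a b].
Proof.
rewrite !inE => /orP[/orP[]|] /eqP ->.
- by exists 1, 1; rewrite mulr1 !scale1r.
- by exists w, w'; rewrite tri_rot; split=> //; ring: w2.
- exists w', w; split=> //; first by ring: w2.
  by rewrite triC tri_rot triC.
Qed.

(** Rotate until [u] is the first vertex, and exchange [a] and [b] if [v] is then the third. The
    last clause records an exchange, because it changes the sign of [det2]. *)
Lemma tri_two x a b u v : inl u \in tri x a b -> inl v \in tri x a b -> u != v ->
  exists a' b', [/\ u = x + (a' + b'), v = x + (w *: a' + w' *: b'),
    tri x a' b' = tri x a b
    & exists c d, c * d = 1 /\
       ((a' = c *: a /\ b' = d *: b) \/ (a' = c *: b /\ b' = d *: a))].
Proof.
move=> /tri_at[c [d [cd [uE] <-]]]; rewrite !inE -uE => /orP[/orP[]|] /eqP[vE].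
- by rewrite vE eqxx.
- move=> _; exists (c *: a), (d *: b); split=> //; exists c, d.
  by split=> //; left.
move=> _; exists (d *: b), (c *: a); split.
- by rewrite [d *: b + _]addrC.
- by rewrite [w *: _ + _]addrC.
- exact: triC.
- by exists d, c; rewrite mulrC; split=> //; right.
Qed.

Lemma det2_tri x a b u v : det2 a b != 0 ->
  inl u \in tri x a b -> inl v \in tri x a b -> u != v ->
  det2 (u - x) (v - x) != 0.
Proof.
move=> ab0 ut vt nuv; have [a' [b' [-> -> _ [c [d [cd ab']]]]]] := tri_two ut vt nuv.
rewrite ![x + _]addrC !addrK -[a' + b']/(a' + b').
have := det2_comb a' b' 1 1 w w'; rewrite !scale1r !mul1r mulr1 => ->.
rewrite mulf_neq0 ?wNw' //.
case: ab' => [[-> ->]|[-> ->]]; rewrite det2Z cd mul1r //.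
by rewrite det2C oppr_eq0.
Qed.

Lemma det2_diag u v : u = v -> det2 u v = 0.
Proof. by move->; have := det2_line v 1 1; rewrite scale1r. Qed.

Lemma card_tri x a b : det2 a b != 0 -> #|tri x a b| = 3.
Proof.
move=> ab0; pose y c d := x + (c *: a + d *: b).
have neq c d c' d' : c * d' - c' * d != 0 -> y c d != y c' d'.
  move=> nz; apply: contraNneq (mulf_neq0 nz ab0) => /addrI E.
  by rewrite -det2_comb det2_diag.
have -> : tri x a b = inl (y w' w) |: [set inl (y 1 1); inl (y w w')].
  by rewrite setUC /tri /y !scale1r.
have n1 : y 1 1 != y w w' by apply: neq; rewrite mul1r mulr1 wNw'.
have n2 : y w' w != y 1 1.
  by apply: neq; rewrite mul1r mulr1 wNw'.
have n3 : y w' w != y w w'.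
  apply: neq; have -> : w' * w' - w * w = - (w' - w) by ring: w2.
  by rewrite oppr_eq0 wNw'.
rewrite cardsU1 cards2 !inE /=.
by rewrite /eq_op /= n1 (negPf n2) (negPf n3).
Qed.

Lemma tri_pair x u v : det2 (u - x) (v - x) != 0 ->
  exists a b, [/\ det2 a b != 0, inl u \in tri x a b & inl v \in tri x a b].
Proof.
set y := u - x; set z := v - x => yz0; have W := wNw'.
have W' : w - w' != 0 by rewrite -opprB oppr_eq0.
(* These solve [a + b = y] and [w a + w' b = z]. *)
exists (- (w' - w)^-1 *: (z - w' *: y)), ((w' - w)^-1 *: (z - w *: y)).
split; last 2 first.
- rewrite !inE; apply/orP; left; apply/orP; left; apply/eqP; congr inl.
  by apply/rowP=> i; rewrite !mxE; field.
- rewrite !inE; apply/orP; left; apply/orP; right; apply/eqP; congr inl.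
  by apply/rowP=> i; rewrite !mxE; field.
rewrite det2Z mulf_neq0 ?mulf_neq0 ?oppr_eq0 ?invr_eq0 //.
have := det2_comb y z (- w') 1 (- w) 1; rewrite !scale1r ![_ *: y + z]addrC !scaleNr.
move=> ->; rewrite mulf_neq0 // (_ : _ - _ = - (w' - w)); last by ring.
by rewrite oppr_eq0.
Qed.

Lemma tri_point x a b p : p \in tri x a b -> exists v, p = inl v.
Proof. by move=> /tri_at[c [d [_ -> _]]]; eexists. Qed.

(** [1 + w + w' = 0] cancels [a] and [b], and independence keeps the three points distinct, so each
    is counted. The sum recovers the centre; the value 0 at infinite points is never reached. *)
Lemma tri_sum x a b : det2 a b != 0 ->
  \sum_(p in tri x a b) (if p is inl v then v else 0) = 3%:R *: x.
Proof.
move=> ab0; have := card_tri x ab0; rewrite /tri setUC cardsU1 cards2.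
case r: (_ \notin _) => //; case q: (_ != _) => // _.
rewrite big_setU1 //= big_setU1 ?inE //= big_set1.
by apply/rowP=> i; rewrite !mxE; ring.
Qed.

Lemma tri_center x x' a b a' b' : det2 a b != 0 -> det2 a' b' != 0 ->
  tri x a b = tri x' a' b' -> x = x'.
Proof.
by move=> ab0 ab'0 E; apply: (scalerI F3); rewrite -(tri_sum x ab0) E tri_sum.
Qed.

End Geometry.

(** * The new systems and their parallel classes *)

Section Construction.
Variables (F : finFieldType) (n : nat) (w : F).
Hypotheses (n_gt0 : (0 < n)%N) (w2 : w * w = - 1 - w) (F3 : 3%:R != 0 :> F).
Variable H : {set F}.
Hypotheses (H0 : 0 \notin H) (HN : forall x : F, x != 0 -> (- x \in H) = (x \notin H)).
Local Notation A := (0 |: H).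
Variable K : F -> F -> {set {set F + bool}}.
Hypotheses (KK : forall t, kirkman A (K t)) (Ks : forall t, special t \in K t 0)
  (Kdisj : forall t t' i i' b, i \in A -> i' \in A ->
     b \in K t i -> b \in K t' i' -> t = t').
Local Notation V := 'rV[F]_n.
Local Notation tri := (tri w).
Implicit Types (a e x u v : V) (c d h s t : F).

Definition line_blocks x e h : {set {set V + bool}} :=
  [set line_pt x e @: (b : {set F + bool}) | b in K (coord e x) h].

Definition tri_blocks x e h : {set {set V + bool}} :=
  [set tri x p.1 (p.2 *: e) | p : V * F & det2 p.1 (p.2 *: e) == h].

Definition big_class x (i : option (V * F)) : {set {set V + bool}} :=
  if i is Some (e, h) then line_blocks x e h :|: tri_blocks x e h
  else \bigcup_(e | lead e == 1) line_blocks x e 0.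

Definition big_colours : {set option (V * F)} :=
  [set i | if i is Some p then (lead p.1 == 1) && (p.2 \in H) else true].

(** At [h = 0] the direction is forgotten: the classes of the special blocks on all lines through
    the centre merge into [None]. *)
Definition colour e h : option (V * F) := if h == 0 then None else Some (e, h).

Lemma H_neq0 h : h \in H -> h != 0.
Proof. by apply: contraTneq => ->. Qed.

Lemma A0 : 0 \in A. Proof. exact: setU11. Qed.

Lemma HA h : h \in H -> h \in A. Proof. exact: setU1r. Qed.

Lemma big_classP x i b : i \in big_colours -> b \in big_class x i ->
  (exists e h b0, [/\ lead e = 1, h \in A, b0 \in K (coord e x) h,
     b = line_pt x e @: b0 & i = colour e h]) \/
  (exists e h a t, [/\ lead e = 1, h \in H, det2 a (t *: e) = h,
     b = tri x a (t *: e) & i = Some (e, h)]).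
Proof.
rewrite inE; case: i => [[e h] /= /andP[/eqP e1 hH]|_] /=; last first.
  case/bigcupP=> e /eqP e1 /imsetP[b0 b0K ->]; left; exists e, 0, b0.
  by rewrite A0 /colour eqxx.
case/setUP=> /imsetP[].
  move=> b0 b0K ->; left; exists e, h, b0.
  by rewrite HA // /colour (negPf (H_neq0 hH)).
by move=> [a t]; rewrite inE /= => /eqP det ->; right; exists e, h, a, t.
Qed.

Lemma line_big_class x e h b0 : lead e = 1 -> h \in A -> b0 \in K (coord e x) h ->
  colour e h \in big_colours /\ line_pt x e @: b0 \in big_class x (colour e h).
Proof.
move=> e1 hA b0K; rewrite /colour; case: eqVneq hA b0K => [->|h0] hA b0K.
  rewrite inE; split=> //; apply/bigcupP; exists e; rewrite ?e1 //.
  exact: imset_f.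
split; first by move: hA; rewrite !inE e1 eqxx (negPf h0).
by rewrite inE imset_f.
Qed.

Lemma tri_big_class x e a t : lead e = 1 -> det2 a (t *: e) \in H ->
  Some (e, det2 a (t *: e)) \in big_colours /\
  tri x a (t *: e) \in big_class x (Some (e, det2 a (t *: e))).
Proof.
move=> e1 detH; rewrite !inE e1 eqxx; split=> //; apply/orP; right.
by apply/imsetP; exists (a, t); rewrite ?inE /=.
Qed.

Lemma colour_inj e e' h h' :
  colour e h = colour e' h' -> h = h' /\ (h = 0 \/ e = e').
Proof.
rewrite /colour; case: (eqVneq h 0) => [->|_]; case: (eqVneq h' 0) => [->|_] //.
  by split=> //; left.
by case=> -> ->; split=> //; right.
Qed.

Lemma colour_Some e e' h h' : colour e h = Some (e', h') -> e = e'.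
Proof. by rewrite /colour; case: eqP => // _ []. Qed.

(** The label [coord e x] is chosen for this: the copies on all lines through [x] share one
    block. *)
Lemma line_pt_special x e : line_pt x e @: special (coord e x) = special x.
Proof.
rewrite /special !imsetU !imset_set1 /=.
by rewrite subrr scale0r addr0.
Qed.

Lemma special_class t b p : b \in K t 0 -> p \in special t -> p \in b ->
  b = special t.
Proof.
by move=> bK ps pb; apply: (kirkman_class_uniq (KK t) A0 bK (Ks t) pb ps).
Qed.

Lemma special_pair t h b p p' : h \in A -> b \in K t h -> p != p' ->
  p \in special t -> p' \in special t -> p \in b -> p' \in b ->
  b = special t /\ h = 0.
Proof.
move=> hA bK npp' ps ps' pb p'b.
exact: (kirkman_pair_uniq (KK t) hA A0 bK (Ks t) npp' pb p'b ps ps').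
Qed.

(** Distinct lines through [x] share only [x] and the infinite points. *)
Lemma line_meet x e e' y y' : lead e = 1 -> lead e' = 1 -> e != e' ->
  line_pt x e y = line_pt x e' y' -> y \in special (coord e x).
Proof.
move=> e1 e'1 nee'; case: y => [s|[]]; rewrite ?inE ?eqxx ?orbT //.
case: y' => [s'|//] /= [/addrI E]; apply: contraNT nee' => nes.
apply/eqP/(dir_uniq e1 e'1 _ E); rewrite subr_eq0.
by apply: contraNneq nes => ->.
Qed.

Lemma mul1_neq0 c d : c * d = 1 -> c != 0 /\ d != 0.
Proof.
move=> cd; have : c * d != 0 by rewrite cd oner_neq0.
by rewrite mulf_eq0 negb_or => /andP.
Qed.

(** For a vertex [x + v], [det2 v (t *: e)] is a nonzero multiple of [det2 a (t *: e)], whereas it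
    vanishes for [v] on [F e]. *)
Lemma tri_off_line x a t e c : det2 a (t *: e) != 0 ->
  inl (x + c *: e) \notin tri x a (t *: e).
Proof.
move=> det; apply/negP=> /(tri_at w2)[k [l [kl [/addrI E] _]]].
have: det2 (k *: a + l *: (t *: e)) (t *: e) = k * det2 a (t *: e).
  by rewrite det2_shift -[t *: e in LHS]scale1r det2Z mulr1.
rewrite -E det2_line => /esym/eqP; rewrite mulf_eq0 (negPf det) orbF.
by have [/negPf->] := mul1_neq0 kl.
Qed.

(** Rotate both triples so that [p = x + v] comes first. Then [v = a + b] with [b = s *: e], and the
    prescribed nonzero value [det2 v b = s * det2 v e] fixes [s], hence [b] and [a]. *)
Lemma tri_class_uniq x e a t a' t' p :
  det2 a (t *: e) != 0 -> det2 a' (t' *: e) = det2 a (t *: e) ->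
  p \in tri x a (t *: e) -> p \in tri x a' (t' *: e) ->
  tri x a (t *: e) = tri x a' (t' *: e).
Proof.
move=> det0 det /(tri_at w2)[k [l [kl -> <-]]] /(tri_at w2)[k' [l' [kl' [/addrI E]
  <-]]].
have {}det : det2 (k *: a) (l *: (t *: e)) = det2 (k' *: a') (l' *: (t' *: e)).
  by rewrite !det2Z kl kl' det.
have {}det0 : det2 (k *: a) (l *: (t *: e)) != 0 by rewrite det2Z kl mul1r.
move: E det det0; rewrite !scalerA; set a1 := k *: a; set a2 := k' *: a'.
move: (l * t) (l' * t') => t1 t2 E.
have a2E : a2 = a1 + (t1 - t2) *: e by rewrite scalerBl addrA E addrK.
have D c b : det2 b (c *: e) = c * det2 b e by rewrite -{1}[b]scale1r det2Z mul1r.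
rewrite !D a2E det2_shift => /eqP; rewrite -subr_eq0 -mulrBl mulf_eq0 => tt.
rewrite mulf_eq0 negb_or => /andP[_ /negPf det0].
move: tt; rewrite det0 orbF subr_eq0 => /eqP->.
by rewrite subrr scale0r addr0.
Qed.

(** With [u] and [v] as first two vertices, both triples yield the same pair [(a1, b1)]. An exchange
    negates [det2], and [H] never contains both [h] and [- h], so it occurs for both triples or for
    neither; then [e] and [h] can be read off from the pair. *)
Lemma tri_pair_uniq x e e' a a' t t' u v : lead e = 1 -> lead e' = 1 ->
  det2 a (t *: e) \in H -> det2 a' (t' *: e') \in H -> u != v ->
  inl u \in tri x a (t *: e) -> inl v \in tri x a (t *: e) ->
  inl u \in tri x a' (t' *: e') -> inl v \in tri x a' (t' *: e') ->
  tri x a (t *: e) = tri x a' (t' *: e') /\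
  Some (e, det2 a (t *: e)) = Some (e', det2 a' (t' *: e')).
Proof.
move=> e1 e'1 dH d'H nuv ut vt ut' vt'.
have [a1 [b1 [u1 v1 <- [k [l [kl E1]]]]]] := tri_two w2 ut vt nuv.
have [a2 [b2 [u2 v2 <- [k' [l' [kl' E2]]]]]] := tri_two w2 ut' vt' nuv.
have [a12 b12] : a1 = a2 /\ b1 = b2.
  have /addrI E := etrans (esym u1) u2; have /addrI E' := etrans (esym v1) v2.
  have W := wNw' w2 F3.
  (* [w' (a + b) - (w a + w' b) = (w' - w) a] eliminates [b]. *)
  have: (- 1 - w - w) *: a1 = (- 1 - w - w) *: a2.
    have := congr2 (fun y z => (- 1 - w) *: y - z) E E'.
    rewrite !scalerDr !opprD ![- (w *: _) - _]addrC.
    by rewrite !addrA !addrK -!scalerBl.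
  move/(scalerI W) => aE; split=> //.
  by move: E; rewrite aE => /addrI.
rewrite a12 b12; split=> //.
have D c a0 e0 : det2 a0 (c *: e0) = c * det2 a0 e0.
  by rewrite -{1}[a0]scale1r det2Z mul1r.
have [k0 l0] := mul1_neq0 kl.
have t0 : t != 0 by apply: contraTneq dH => ->; rewrite D mul0r.
have [d1 d2] : (a1 = k *: a /\ b1 = l *: (t *: e) /\ det2 a1 b1 = det2 a (t *: e) \/
       a1 = k *: (t *: e) /\ b1 = l *: a /\ det2 a1 b1 = - det2 a (t *: e)) /\
   (a2 = k' *: a' /\ b2 = l' *: (t' *: e') /\ det2 a2 b2 = det2 a' (t' *: e') \/
       a2 = k' *: (t' *: e') /\ b2 = l' *: a' /\ det2 a2 b2 = - det2 a' (t' *: e')).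
  split; [case: E1 => [[-> ->]|[-> ->]] | case: E2 => [[-> ->]|[-> ->]]];
    rewrite ?det2Z ?kl ?kl' mul1r; [left|right|left|right]; do ?split=> //;
      exact: det2C.
have opp h : h \in H -> - h \in H -> False.
  by move=> hH; rewrite HN ?hH // H_neq0.
case: d1 d2 => [[_ [b1E d1]]|[a1E [_ d1]]] [[_ [b2E d2]]|[a2E [_ d2]]].
- congr (Some (_, _)); last by rewrite -d1 -d2 a12 b12.
  apply: (dir_uniq e1 e'1 (mulf_neq0 l0 t0) (c' := l' * t')).
  by rewrite -!scalerA -b1E -b2E.
- case: (opp (det2 a' (t' *: e'))) => //.
  by rewrite -d2 -a12 -b12 d1.
- case: (opp (det2 a (t *: e))) => //.
  by rewrite -d1 a12 b12 d2.
- congr (Some (_, _)); last by apply: oppr_inj; rewrite -d1 -d2 a12 b12.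
  apply: (dir_uniq e1 e'1 (mulf_neq0 k0 t0) (c' := k' * t')).
  by rewrite -!scalerA -a1E -a2E.
Qed.

Lemma on_line x u : exists e c, lead e = 1 /\ u = x + c *: e.
Proof.
have [->|nux] := eqVneq u x; last first.
  have [|e e1 [c _ ce]] := @dirP _ _ (u - x); first by rewrite subr_eq0.
  by exists e, c; rewrite -ce addrC subrK.
(* The point [x] lies on every line through [x]; positivity of [n] provides a direction. *)
have [|e e1 _] := @dirP F n (const_mx 1).
  apply/rV0Pn; exists (Ordinal n_gt0); rewrite mxE; exact: oner_neq0.
by exists e, 0; rewrite scale0r addr0.
Qed.

Lemma on_line_pt x p : exists e y, lead e = 1 /\ p = line_pt x e y.
Proof.
case: p => [u|i]; last by have [e [_ [e1 _]]] := on_line x 0; exists e, (inr i).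
have [e [c [e1 ->]]] := on_line x u.
by exists e, (inl (coord e x + c)); rewrite line_ptE.
Qed.

Lemma on_line_pt2 x u v : det2 (u - x) (v - x) = 0 ->
  exists e y y', [/\ lead e = 1, inl u = line_pt x e y & inl v = line_pt x e y'].
Proof.
have [->|nux] := eqVneq u x => [_|det].
  have [e [c [e1 ->]]] := on_line x v.
  exists e, (inl (coord e x + 0)), (inl (coord e x + c)).
  by rewrite !line_ptE scale0r addr0.
have [|c vE] := det2_eq0 _ (etrans (det2C (u - x) (v - x)) (etrans (congr1 _ det)
  (oppr0 _))).
  by rewrite subr_eq0.
have [e [d [e1 uE]]] := on_line x u.
exists e, (inl (coord e x + d)), (inl (coord e x + c * d)); rewrite !line_ptE -uE.
split=> //; congr inl; rewrite -scalerA (_ : d *: e = u - x) -?vE.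
  by rewrite addrC subrK.
by rewrite uE addrC addKr.
Qed.

Lemma big_pair x p p' : p != p' ->
  exists i b, [/\ i \in big_colours, b \in big_class x i, p \in b & p' \in b].
Proof.
move=> npp'.
have line e y y' : lead e = 1 -> p = line_pt x e y -> p' = line_pt x e y' ->
    exists i b, [/\ i \in big_colours, b \in big_class x i, p \in b & p' \in b].
  move=> e1 pE p'E; have nyy' : y != y'.
    by apply: contraNneq npp' => E; rewrite pE p'E E.
  have [h [b0 [hA b0K yb y'b]]] := kirkman_pair (KK (coord e x)) nyy'.
  have [iA bi] := line_big_class e1 hA b0K.
  by exists (colour e h), (line_pt x e @: b0); rewrite pE p'E !imset_f.
case: p npp' line => [u|i]; last first.
  move=> _ line; have [e [y [e1 p'E]]] := on_line_pt x p'.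
  exact: (line e (inr i) y).
case: p' => [v|i]; last first.
  move=> _ line; have [e [y [e1 pE]]] := on_line_pt x (inl u).
  exact: (line e y (inr i)).
move=> _ line; have [det|det] := eqVneq (det2 (u - x) (v - x)) 0.
  by have [e [y [y' [e1 uE vE]]]] := on_line_pt2 det; apply: (line e y y').
have [a [b [ab0 ut vt]]] := tri_pair w2 F3 det.
(* Exchanging [a] and [b] keeps the triple and negates the determinant, so one of the two orders
   puts it in [H]. *)
have [a' [b' [abH ut' vt']]] : exists a' b',
    [/\ det2 a' b' \in H, inl u \in tri x a' b' & inl v \in tri x a' b'].
  case abH: (det2 a b \in H); first by exists a, b.
  by exists b, a; rewrite det2C HN // abH triC.
have [|e e1 [c _ b'E]] := @dirP _ _ b'.
  apply: contraTneq abH => ->.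
  by rewrite -(scale0r 0) -[a']scale1r det2Z mulr0 mul0r.
rewrite b'E in abH ut' vt'; have [iA bi] := tri_big_class x e1 abH.
by exists (Some (e, det2 a' (c *: e))), (tri x a' (c *: e)).
Qed.

Lemma tri_line_pair x a b e (b0 : {set F + bool}) p p' : det2 a b != 0 -> p != p' ->
  p \in tri x a b -> p' \in tri x a b ->
  p \in line_pt x e @: b0 -> p' \in line_pt x e @: b0 -> False.
Proof.
move=> det npp' pt p't; have [u uE] := tri_point w2 pt; have [v vE] := tri_point w2 p't.
rewrite {}uE {}vE in npp' pt p't *.
case/imsetP=> y _ /line_pt_inl[c _ uE] /imsetP[y' _ /line_pt_inl[d _ vE]].
have nuv : u != v by apply: contraNneq npp' => ->.
have := det2_tri w2 F3 det pt p't nuv.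
by rewrite uE vE ![x + _]addrC !addrK det2_line eqxx.
Qed.

Lemma big_kirkman x : kirkman big_colours (big_class x).
Proof.
split.
- move=> i b iA /(big_classP iA)[[e [h [b0 [e1 hA b0K -> _]]]]|
  [e [h [a [t [_ hH det -> _]]]]]].
    by rewrite card_imset; [apply: kirkman_card (KK _) _ _ hA b0K | apply: line_pt_inj].
  by rewrite (card_tri w2 F3) // det H_neq0.
- move=> i p iA.
  have line e h y : lead e = 1 -> h \in A -> p = line_pt x e y -> i = colour e h ->
      exists2 b, b \in big_class x i & p \in b.
    move=> e1 hA -> ->; have [b0 b0K yb0] := kirkman_cover (KK (coord e x)) y hA.
    exists (line_pt x e @: b0); last exact: imset_f.
    by have [] := line_big_class e1 hA b0K.
  case: i iA line => [[e h]|_ line]; last first.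
    have [e [y [e1 pE]]] := on_line_pt x p; apply: (line e 0 y e1 A0 pE).
    by rewrite /colour eqxx.
  rewrite inE /= => /andP[/eqP e1 hH] line.
  have iE : Some (e, h) = colour e h by rewrite /colour (negPf (H_neq0 hH)).
  case: p line => [u|c] line; last exact: (line e h (inr c) e1 (HA hH)).
  have [det|det] := eqVneq (det2 (u - x) e) 0.
    have [c uE] := det2_eq0 (dir_neq0 e1) det.
    apply: (line e h (inl (coord e x + c)) e1 (HA hH)) => //.
    by rewrite line_ptE -uE addrC subrK.
  (* For [v = u - x], [t] solves [det2 v (t *: e) = h], and this [a] makes [u] the vertex with
     [k = 0]. *)
  pose t := h / det2 (u - x) e; pose a := u - x - t *: e.
  have detE : det2 a (t *: e) = h.
    rewrite -[a]scale1r det2Z mul1r /a -scaleNr det2_shift.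
    by rewrite /t divfK.
  have detH : det2 a (t *: e) \in H by rewrite detE.
  have [_] := tri_big_class x e1 detH; rewrite detE => bi.
  exists (tri x a (t *: e)) => //.
  by rewrite !inE subrK [x + _]addrC subrK eqxx.
- move=> i b b' p iA.
  case/(big_classP iA)=> [[e [h [b0 [e1 hA b0K -> ->]]]]|
    [e [h [a [t [e1 hH det -> iE]]]]]].
    move=> b'i; have [iA' _] := line_big_class e1 hA b0K.
    case: (big_classP iA' b'i) => [[e' [h' [b0' [e'1 h'A b0'K -> cE]]]]|].
      move=> /imsetP[y yb0 ->] /imsetP[y' y'b0' yy'].
      have [ee'|nee'] := eqVneq e e'.
        rewrite -ee' in b0'K yy' *; have := line_pt_inj e1 yy' => {}yy'.
        have [hh' _] := colour_inj cE; rewrite -hh' -yy' in b0'K y'b0'.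
        by rewrite (kirkman_class_uniq (KK _) hA b0K b0'K yb0 y'b0').
      (* Different directions share a class only at colour 0; there the common point lies in the
         special block, so both blocks are the special one. *)
      have [h0 h'0] : h = 0 /\ h' = 0.
        have [<- [->|ee']] := colour_inj cE => //.
        by rewrite ee' eqxx in nee'.
      rewrite h0 h'0 in b0K b0'K.
      have ys := line_meet e1 e'1 nee' yy'.
      rewrite eq_sym in nee'; have y's := line_meet e'1 e1 nee' (esym yy').
      rewrite (special_class b0K ys yb0) (special_class b0'K y's y'b0').
      by rewrite !line_pt_special.
    case=> e' [h' [a [t [e'1 h'H det -> cE]]]].
    rewrite -(colour_Some cE) in det *.
    move=> pl pt; have [u uE] := tri_point w2 pt; rewrite {}uE in pl pt.
    case/imsetP: pl => y _ /line_pt_inl[c _ uE]; rewrite uE in pt.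
    by have := @tri_off_line x a t e c; rewrite det pt => /(_ (H_neq0 h'H)).
  move=> b'i; case: (big_classP iA b'i).
    case=> e' [h' [b0 [e'1 h'A b0K -> cE]]].
    rewrite iE in cE; rewrite (colour_Some (esym cE)).
    move=> pt pl; have [u uE] := tri_point w2 pt; rewrite {}uE in pl pt.
    case/imsetP: pl => y _ /line_pt_inl[c _ uE]; rewrite uE in pt.
    by have := @tri_off_line x a t e c; rewrite det pt => /(_ (H_neq0 hH)).
  case=> e' [h' [a' [t' [e'1 h'H det' -> cE]]]].
  move: cE; rewrite iE => -[ee' hh']; rewrite -ee' -hh' in det' *.
  by apply: tri_class_uniq; rewrite ?det ?H_neq0.
- exact: big_pair.
- move=> i i' b b' p p' iA i'A bi b'i' npp'.
  case: (big_classP iA bi) =>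
    [[e [h [b0 [e1 hA b0K -> ->]]]]|[e [h [a [t [e1 hH det -> ->]]]]]].
    case: (big_classP i'A b'i') => [[e' [h' [b0' [e'1 h'A b0'K -> ->]]]]|].
      case/imsetP=> y yb0 pE /imsetP[z zb0 p'E] /imsetP[y' y'b0' pE'] /imsetP[z'
        z'b0' p'E'].
      have nyz : y != z by apply: contraNneq npp' => E; rewrite pE p'E E.
      have nyz' : y' != z' by apply: contraNneq npp' => E; rewrite pE' p'E' E.
      have yy' := etrans (esym pE) pE'; have zz' := etrans (esym p'E) p'E'.
      have [ee'|nee'] := eqVneq e e'.
        rewrite -ee' in b0'K yy' zz' *.
        rewrite -(line_pt_inj e1 yy') -(line_pt_inj e1 zz') in y'b0' z'b0'.
        by have [-> ->] := kirkman_pair_uniq (KK _) hA h'A b0K b0'K nyz yb0 zb0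
          y'b0' z'b0'.
      (* Both common points lie in the special block of each copy, which forces both blocks to be
         special, of colour 0. *)
      have [ys zs] := (line_meet e1 e'1 nee' yy', line_meet e1 e'1 nee' zz').
      have [-> ->] := special_pair hA b0K nyz ys zs yb0 zb0.
      rewrite eq_sym in nee'.
      have y's := line_meet e'1 e1 nee' (esym yy').
      have z's := line_meet e'1 e1 nee' (esym zz').
      have [-> ->] := special_pair h'A b0'K nyz' y's z's y'b0' z'b0'.
      by rewrite !line_pt_special /colour eqxx.
    case=> e' [h' [a [t [e'1 h'H det -> _]]]] pl p'l pt p't.
    by case: (@tri_line_pair x a (t *: e') e b0 p p'); rewrite ?det ?H_neq0.
  case: (big_classP i'A b'i') => [[e' [h' [b0' [e'1 h'A b0'K -> _]]]]|].
    move=> pt p't pl p'l.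
    by case: (@tri_line_pair x a (t *: e) e' b0' p p'); rewrite ?det ?H_neq0.
  case=> e' [h' [a' [t' [e'1 h'H det' -> ->]]]] pt p't.
  have [u uE] := tri_point w2 pt; have [v vE] := tri_point w2 p't.
  rewrite {}uE {}vE in npp' pt p't * => pt' p't'; rewrite -det in hH *;
    rewrite -det' in h'H *.
  by apply: tri_pair_uniq pt p't pt' p't' => //; apply: contraNneq npp' => ->.
Qed.

(** * Disjointness of systems with different centres *)

(** The differences of the other two vertices from the first have determinant [3 (w' - w) det2 a b],
    which is nonzero. The line may miss the centre [x'], so this separates the triples of one system
    from the line blocks of another. *)
Lemma tri_not_collinear x x' a b e : det2 a b != 0 ->
  (forall p, p \in tri x' a b -> exists c, p = inl (x + c *: e)) -> False.
Proof.
move=> ab0 col.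
have [|c0 [E0]] := col (inl (x' + (a + b))); first by rewrite !inE eqxx.
have [|c1 [E1]] := col (inl (x' + (w *: a + (- 1 - w) *: b)));
  first by rewrite !inE eqxx orbT.
have [|c2 [E2]] := col (inl (x' + ((- 1 - w) *: a + w *: b)));
  first by rewrite !inE eqxx !orbT.
have := det2_comb a b (w - 1) (- 1 - w - 1) (- 1 - w - 1) (w - 1).
have -> : (w - 1) *: a + (- 1 - w - 1) *: b = (c1 - c0) *: e.
  transitivity (x + c1 *: e - (x + c0 *: e));
    last by rewrite opprD addrACA subrr add0r -scalerBl.
  by rewrite -E1 -E0; apply/rowP=> i; rewrite !mxE; ring.
have -> : (- 1 - w - 1) *: a + (w - 1) *: b = (c2 - c0) *: e.
  transitivity (x + c2 *: e - (x + c0 *: e));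
    last by rewrite opprD addrACA subrr add0r -scalerBl.
  by rewrite -E2 -E0; apply/rowP=> i; rewrite !mxE; ring.
rewrite det2_line => /esym/eqP; rewrite mulf_eq0 (negPf ab0) orbF.
have -> : (w - 1) * (w - 1) - (- 1 - w - 1) * (- 1 - w - 1) = 3%:R * (- 1 - w - w).
  by ring.
by rewrite mulf_eq0 (negPf F3) (negPf (wNw' w2 F3)).
Qed.

(** A block with both infinite points is special, and its finite point is the centre. Any other
    block has two finite points, which fix the line; both copies then use the same map, and [Kdisj]
    gives [x] and [x'] the same coordinate on that line. *)
Lemma line_disjoint x x' e e' h h' b0 b0' : lead e = 1 -> lead e' = 1 ->
  h \in A -> h' \in A -> b0 \in K (coord e x) h -> b0' \in K (coord e' x') h' ->
  line_pt x e @: b0 = line_pt x' e' @: b0' -> x = x'.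
Proof.
move=> e1 e'1 hA h'A b0K b0'K E.
have inr_line (y f : V) (B : {set F + bool}) i :
    (inr i \in line_pt y f @: B) = (inr i \in B).
  apply/imsetP/idP=> [[[s|j]] // jB [->] //|iB]; by exists (inr i).
have inr_special i t : inr i \in special t by case: i; rewrite !inE.
case: (boolP [forall i, inr i \in b0]) => [/forallP all0|].
  have all0' i : inr i \in b0' by rewrite -(inr_line x' e') -E inr_line.
  have nb : inr true != inr false :> F + bool by [].
  have [b0E _] := special_pair hA b0K nb (inr_special _ _) (inr_special _ _) (all0
    _) (all0 _).
  have [b0'E _] := special_pair h'A b0'K nb (inr_special _ _) (inr_special _ _)
    (all0' _) (all0' _).
  move: E; rewrite b0E b0'E !line_pt_special => /setP/(_ (inl x)).
  by rewrite !inE eqxx => /esym/eqP[].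
case/forallPn=> i ib0.
(* Of the three points of [b0] at most one is infinite, namely [inr (~~ i)]. *)
have [s [s' [nss' sb0 s'b0]]] : exists s s', [/\ s != s', inl s \in b0 & inl s' \in b0].
  have: (1 < #|b0 :\ inr (~~ i)|)%N.
    have := kirkman_card (KK _) hA b0K; rewrite (cardsD1 (inr (~~ i))).
    by case: (_ \in _); case: #|_ :\ _| => [|[|k]].
  have noinr j : inr j \in b0 :\ inr (~~ i) -> False.
    rewrite !inE => /andP[nj jb0]; move/negP: ib0; apply.
    by case: (i) (j) nj jb0 => [] [].
  case/card_gt1P=> -[s|j] [[s'|j']] [yb0 y'b0];
    try by [case: (noinr j)|case: (noinr j')].
  move=> nss'; exists s, s'; move: yb0 y'b0; rewrite !inE => /andP[_ ->] /andP[_ ->].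
  by split=> //; apply: contraNneq nss' => ->.
have sE' := imset_f (line_pt x e) sb0; have s'E' := imset_f (line_pt x e) s'b0.
rewrite E in sE' s'E'.
case/imsetP: sE' => y _ /line_pt_inl[c _ uE].
case/imsetP: s'E' => y' _ /line_pt_inl[d _ vE].
have ee' : e = e'.
  apply: (dir_uniq e1 e'1 (c := s - s') (c' := c - d)); first by rewrite subr_eq0.
  transitivity (x' + c *: e' - (x' + d *: e')).
    by rewrite -uE -vE opprD addrACA subrr add0r -scalerBl opprB addrA subrK.
  by rewrite opprD addrACA subrr add0r -scalerBl.
rewrite -{}ee' in b0'K E uE vE.
have [k x'E] : exists k, x' = x + k *: e.
  exists (s - coord e x - c); rewrite scalerBl addrA uE addrK //.
rewrite x'E in b0'K E *; rewrite (eq_imset _ (line_pt_shift _ _ e1)) in E.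
have bb' := imset_inj (line_pt_inj e1) E; rewrite -bb' in b0'K.
have := Kdisj hA h'A b0K b0'K; rewrite coord_lin -/(lead e) e1 mulr1.
by rewrite -[LHS]addr0 => /addrI <-; rewrite scale0r addr0.
Qed.

Lemma big_disjoint x x' i i' b : i \in big_colours -> i' \in big_colours ->
  b \in big_class x i -> b \in big_class x' i' -> x = x'.
Proof.
move=> iA i'A bi bi'.
have line_tri y y' e (b0 : {set F + bool}) a a' :
    line_pt y e @: b0 = tri y' a a' -> det2 a a' != 0 -> False.
  move=> E det; apply: (@tri_not_collinear y y' a a' e) => // p pt.
  have [u uE] := tri_point w2 pt; move: pt; rewrite -E uE.
  by case/imsetP=> z _ /line_pt_inl[k _ ->]; exists k.
case: (big_classP iA bi) =>
  [[e [h [b0 [e1 hA b0K bE _]]]]|[e [h [a [t [e1 hH det bE _]]]]]];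
  case: (big_classP i'A bi') =>
    [[e' [h' [b0' [e'1 h'A b0'K bE' _]]]]|[e' [h' [a' [t' [e'1 h'H det' bE' _]]]]]].
- by apply: (line_disjoint e1 e'1 hA h'A b0K b0'K); rewrite -bE.
- by case: (line_tri x x' e b0 a' (t' *: e')); rewrite -?bE // det' H_neq0.
- by case: (line_tri x' x e' b0' a (t *: e)); rewrite -?bE' // det H_neq0.
- apply: (tri_center w2 F3 _ _ (etrans (esym bE) bE')).
    by rewrite det H_neq0.
  by rewrite det' H_neq0.
Qed.

Lemma big_LKTS : LKTS_exists (#|F| ^ n + 2).
Proof.
pose S x := \bigcup_(i in big_colours) big_class x i.
have S_meet x x' b : b \in S x -> b \in S x' -> x = x'.
  by case/bigcupP=> i iA bi /bigcupP[i' i'A]; apply: big_disjoint iA i'A bi.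
have SI : injective S.
  (* Any block of [S x] would do here; one through the two infinite points shows that there is
     one. *)
  move=> x x' E; have [i [b [iA bi _ _]]] := @big_pair x (inr true) (inr false) isT.
  have bS : b \in S x by apply/bigcupP; exists i.
  by apply: (S_meet _ _ _ bS); rewrite -E.
exists (V + bool)%type, [set S x | x : V].
have cV : #|{: V + bool}| = (#|F| ^ n + 2)%N.
  by rewrite card_sum card_bool card_mx mul1n.
split=> //; split.
- by rewrite card_imset // cV addnK card_mx mul1n.
- move=> _ /imsetP[x _ ->]; apply: kirkman_KTS; last exact: big_kirkman.
  by rewrite cV addn2.
- move=> _ _ /imsetP[x _ ->] /imsetP[x' _ ->]; apply: contraNT.
  by case/pred0Pn=> b /andP[/= bx bx']; rewrite (S_meet _ _ _ bx bx').
Qed.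

End Construction.

(* Specialisation to the field of order [q] *)
Local Close Scope ring_scope.

Theorem theorem2 (q : nat) (hq : prime_power q) (hq6 : q = 1 %[mod 6])
    (hL : LKTS_exists (q + 2)) (n : nat) (hn : 2 <= n) :
  LKTS_exists (q ^ n + 2).
Proof.
have [p [k [p_pr k_gt0 qE]]] := hq.
have [F Fp cF] := pPrimePowerField p_pr k_gt0.
rewrite -qE in cF; have n_gt0 : 0 < n := ltnW hn.
have q0 : (q%:R = 0 :> F)%R.
  by rewrite qE natrX (pcharf0 Fp) expr0n; case: (k) k_gt0.
have qdiv : q = (q %/ 6 * 6).+1 by rewrite {1}(divn_eq q 6) hq6 addn1.
(* If a divisor [d] of 6 vanished in [F], then [q = 1] modulo 6 would give [q = 1] in [F], where
   [q = 0]. This is used for 2 and 3. *)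
have nz d : d %| 6 -> (d%:R != 0 :> F)%R.
  case/dvdnP=> m E; apply/eqP=> d0; move: q0;
    rewrite qdiv E mulnA -addn1 natrD natrM d0.
  by rewrite mulr0 add0r => /eqP; rewrite oner_eq0.
have [||w w2] := @cube_root1 F; first exact: nz.
  by rewrite cF qdiv /= dvdn_mull.
have [|H [H0 HN cH]] := @half_nonzero F; first exact: nz.
(* [0 |: H] has [(q + 1) / 2] elements, the number of parallel classes of a KTS of order [q + 2]; 0
   names the class of the special block. *)
have [|||K [KK Ks Kdisj]] := @LKTS_kirkman F F (0 |: H)%R 0%R.
- by rewrite cF.
- exact: setU11.
- by rewrite cardsU1 H0 cH.
rewrite -cF; apply: (big_LKTS n_gt0 w2 _ H0 HN KK Ks Kdisj).
exact: nz.
Qed.
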